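(* Let $n\ge4$ be fixed. For $F>0$ the first Hopf or Hopf-Hopf bifurcation of the trivial equilibrium $x_F=(F,\dots,F)$ of the Lorenz-96 model occurs for the eigenvalue pair with index $$l_1(n)=\operatorname*{arg\,max}_{0<l<n/3} f(l,n)$$ (the maximum being over integers $l$), which satisfies the bounds $$\frac n6\le l_1(n)\le\frac n4,$$ except for $n=7$, in which case one has $l_1(7)=1$. In particular, if the first bifurcation is a Hopf bifurcation, then this bifurcation is supercritical.
   Context: The Lorenz-96 model of dimension $n$ with parameter $F\in\mathbb{R}$ is the system of ordinary differential equations $\dot x_j = x_{j-1}(x_{j+1}-x_{j-2})-x_j+F$, $j=1,\dots,n$, with indices taken modulo $n$. It has the trivial equilibrium $x_F=(F,\dots,F)$. Put $$f(j,n)=\cos\tfrac{2\pi j}{n}-\cos\tfrac{4\pi j}{n},\qquad g(j,n)=-\sin\tfrac{2\pi j}{n}-\sin\tfrac{4\pi j}{n}.$$ For $n\ge4$ the eigenvalues of the Jacobian matrix at $x_F$ are $\lambda_j(F,n)=-1+F f(j,n)+iF g(j,n)$, $j=0,\dots,n-1$, and $\lambda_{n-j}=\overline{\lambda_j}$ for $1\le j\le n-1$. The pair $\{\lambda_j,\lambda_{n-j}\}$ is called the $j$-th eigenvalue pair. For integers $l$ with $0<l<\tfrac n2$, $l\ne\tfrac n3$, the $l$-th pair has zero real part exactly at $F_{\mathrm H}(l,n)=1/f(l,n)$. The normalized eigenvector for $\lambda_j$ is $v_j=\tfrac{1}{\sqrt n}(1,\rho_j,\dots,\rho_j^{n-1})^\top$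 with $\rho_j=e^{-2\pi i j/n}$. The first bifurcation for $F>0$ is the one with the smallest bifurcation value $F_{\mathrm H}(l,n)>0$. It is a Hopf-Hopf bifurcation if two distinct eigenvalue pairs cross the imaginary axis at this value (for $n=12$ the maximizers are $l=2,3$; if the maximizer is not unique, $l_1(n)$ stands for any maximizer), and a Hopf bifurcation if only one pair does; for the latter one also requires that the pair be nonzero and cross with nonzero speed in $F$ and that the first Lyapunov coefficient $\ell_1$ be nonzero. A Hopf bifurcation is supercritical if $\ell_1<0$ and subcritical if $\ell_1>0$. First Lyapunov coefficient (for the $l$-th pair): with $y_j=x_j-F$ the system reads $\dot y=Ay+\tfrac12B(y,y)$, where $A$ is the Jacobian matrix at $x_F$ and $B_k(x,y)=x_{k-1}(y_{k+1}-y_{k-2})+y_{k-1}(x_{k+1}-x_{k-2})$ (indices modulo $n$), extended complex-bilinearly. At $F=F_{\mathrm H}(l,n)$ let $\pm i\omega_0$, $\omega_0>0$, be the imaginary eigenvalues, and let $Aq=i\omega_0q$, $A^\top p=-i\omega_0p$, $\langle q,q\rangle=\langle p,q\rangle=1$ (one takes $q=p=v_{n-l}$), where $\langle x,y\rangle=\sum_k\bar x_ky_k$. Then $$\ell_1=\frac{1}{2\omega_0}\mathrm{Re}\left[-2\langle p,B(q,A^{-1}B(q,\bar q))\rangle+\langle p,B(\bar q,(2i\omega_0I_n-A)^{-1}B(q,q))\rangle\right].$$ *)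

(* Defs.v *)
From HB Require Import structures.
From mathcomp Require Import all_boot all_order all_algebra.
From mathcomp Require Import complex.
From mathcomp Require Import all_classical all_reals all_analysis.

Set Implicit Arguments.
Unset Strict Implicit.
Unset Printing Implicit Defensive.

Import Order.TTheory GRing.Theory Num.Theory.
Import numFieldNormedType.Exports.

Local Open Scope ring_scope.

(* Coordinates are indexed by 'I_n, i.e. by 0, .., n-1 instead of 1, .., n;
   [ordS] and [ord_pred] are the cyclic successor and predecessor. *)
Section Model.
Variables (R : realType) (n : nat).

Definition lorenz96 (F : R) (x : 'rV[R]_n) : 'rV[R]_n :=
  \row_j (x 0 (ord_pred j) * (x 0 (ordS j) - x 0 (ord_pred (ord_pred j)))
          - x 0 j + F).

Definition trivial_equilibrium (F : R) : 'rV[R]_n := const_mx F.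

Lemma lorenz96_trivial_equilibrium (F : R) :
  lorenz96 F (trivial_equilibrium F) = 0.
Proof. by apply/rowP => j; rewrite !mxE subrr mulr0 add0r addNr. Qed.

(* ['J] acts on row vectors from the right; the transpose is the usual
   Jacobian, acting on column vectors from the left. *)
Definition jacobian96 (F : R) : 'M[R[i]]_n :=
  map_mx (real_complex R) ('J (lorenz96 F) (trivial_equilibrium F))^T.

(* Twice the polarized quadratic part of [lorenz96] (which is B(y,y)/2). *)
Definition l96B (x y : 'cV[R[i]]_n) : 'cV[R[i]]_n :=
  \col_k (x (ord_pred k) 0 * (y (ordS k) 0 - y (ord_pred (ord_pred k)) 0)
          + y (ord_pred k) 0 * (x (ordS k) 0 - x (ord_pred (ord_pred k)) 0)).

(* conjugate-linear in the first argument *)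
Definition cdot (x y : 'cV[R[i]]_n) : R[i] :=
  \sum_(k < n) conjc (x k 0) * y k 0.

End Model.

Section Spectrum.
Variables (R : realType) (n : nat).

Definition angle (j : nat) : R := 2 * pi * j%:R / n%:R.

Definition f96 (j : nat) : R := cos (angle j) - cos (2 * angle j).
Definition g96 (j : nat) : R := - sin (angle j) - sin (2 * angle j).

(* For n >= 4 these are the eigenvalues of [jacobian96 n F], j = 0, .., n-1,
   with eigenvectors (rho_j ^ k)_(0 <= k < n), rho_j = exp (- i * angle j). *)
Definition lambda96 (F : R) (j : nat) : R[i] :=
  Complex (-1 + F * f96 j) (F * g96 j).

(* [l] indexes a genuine pair {lambda_l, lambda_(n-l)} with l <> n - l. *)
Definition pair_index (l : nat) : Prop := (0 < l)%N /\ l%:R < n%:R / 2 :> R.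

Definition hopf_index (l : nat) : Prop :=
  pair_index l /\ l%:R <> n%:R / 3 :> R.

Definition FH (l : nat) : R := (f96 l)^-1.

(* The real part of the [l]-th pair vanishes and changes sign at [F0]. *)
Definition pair_crosses (l : nat) (F0 : R) : Prop :=
  complex.Re (lambda96 F0 l) = 0 /\
  exists2 d : R, 0 < d &
    forall a b : R, F0 - d < a -> a < F0 -> F0 < b -> b < F0 + d ->
      complex.Re (lambda96 a l) * complex.Re (lambda96 b l) < 0.

Definition first_bifurcation (F : R) : Prop :=
  [/\ 0 < F,
      exists2 l, hopf_index l & F = FH l &
      forall l, hopf_index l -> 0 < FH l -> F <= FH l].

Definition critical_vectors (F w0 : R) (q p : 'cV[R[i]]_n) : Prop :=
  [/\ 0 < w0,
      jacobian96 n F *m q = Complex 0 w0 *: q,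
      (jacobian96 n F)^T *m p = - Complex 0 w0 *: p,
      cdot q q = 1 &
      cdot p q = 1].

Definition lyapunov1 (F w0 : R) (q p : 'cV[R[i]]_n) : R :=
  let A := jacobian96 n F in
  let qbar := map_mx conjc q in
  (2 * w0)^-1 *
  complex.Re
    (- 2 * cdot p (l96B q (invmx A *m l96B q qbar))
     + cdot p (l96B qbar
                 (invmx ((2 * Complex 0 w0)%:M - A) *m l96B q q))).

(* [ell] is the first Lyapunov coefficient of the [l]-th pair at F_H(l,n),
   computed with some admissible choice of the critical vectors; the value
   does not depend on that choice when only this pair crosses. *)
Definition first_lyapunov (l : nat) (ell : R) : Prop :=
  exists w0 q p,
    [/\ w0 = `|complex.Im (lambda96 (FH l) l)|,
        critical_vectors (FH l) w0 q p &
        ell = lyapunov1 (FH l) w0 q p].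

Definition hopf_bifurcation (l : nat) : Prop :=
  [/\ hopf_index l /\ pair_crosses l (FH l),
      forall k, pair_index k -> pair_crosses k (FH l) -> k = l,
      lambda96 (FH l) l <> 0,
      derive1 (fun F : R => complex.Re (lambda96 F l)) (FH l) <> 0 &
      (exists ell, first_lyapunov l ell) /\
      (forall ell, first_lyapunov l ell -> ell <> 0)].

Definition hopf_hopf_bifurcation (l k : nat) : Prop :=
  [/\ l <> k,
      hopf_index l /\ pair_crosses l (FH l),
      hopf_index k /\ pair_crosses k (FH l) &
      forall m, pair_index m -> pair_crosses m (FH l) -> m = l \/ m = k].

Definition supercritical (l : nat) : Prop :=
  hopf_bifurcation l /\ forall ell, first_lyapunov l ell -> ell < 0.

Definition l1_admissible (l : nat) : Prop :=
  (0 < l)%N /\ l%:R < n%:R / 3 :> R.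

(* [l] is a maximizer; it need not be unique, e.g. l = 2, 3 for n = 12. *)
Definition is_l1 (l : nat) : Prop :=
  l1_admissible l /\ forall k, l1_admissible k -> f96 k <= f96 l.

End Spectrum.

(* Main.v *)
From HB Require Import structures.
Require Import Defs.
From mathcomp Require Import all_boot all_order all_algebra.
From mathcomp Require Import complex ring lra zify.
From mathcomp Require Import all_classical all_reals all_analysis.
Import Order.TTheory GRing.Theory Num.Theory.
Import numFieldNormedType.Exports.
Local Open Scope ring_scope.

(** Write [t] for the angle [2 pi j / n] and [c = cos t].  Then
    [f96 = (1 - c) (1 + 2 c) = 1 + c - 2 c^2] is a downward parabola in [c],
    and since [cos] is injective on [[0, pi]] everything about the ordering of
    the numbers [f96 j] can be read off from it.  The value is positive exactly
    for [0 < j < n/3], so the smallest positive [FH l = 1 / f96 l] belongs to a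
    maximizer of [f96] over that range ([first_bifurcation_leading]).  The value
    is at least 1 exactly when [0 <= c <= 1/2], i.e. when [n/6 <= j <= n/4]
    ([f96_ge1]); such an integer exists for all [n >= 4] but [n = 7], which
    locates the maximizer ([leading_bounds]); for [n = 7] the two candidates are
    compared by hand ([leading_seven]).  A parabola takes a value at most twice,
    so at most two pairs cross together ([f96_eq_three]): the bifurcation is
    Hopf or Hopf-Hopf, once the Lyapunov coefficient is known not to vanish.

    For that coefficient, the Fourier modes [mode z = (z^k)_k] with [z^n = 1]
    diagonalize the Jacobian ([jacobian96_mode]), and [l96B] maps a pair of modes
    to a multiple of their product ([l96B_mode]).  With [q = d mode z],
    [w = z - z^-2], and [mu = 2 i w0 - lambda(z^2)] this gives
      [l1 = - 1 / (n w0) (2 (Re w)^2 + |z^3 - 1|^2 Re (1 / mu))]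
    ([lyapunov1_mode]).  Criticality says [F Re w = 1], so the first term is
    positive; and [Re mu = - Re lambda(z^2) >= 0], because at the first
    bifurcation no eigenvalue has positive real part.  Hence [l1 < 0] without
    any estimate of trigonometric functions ([lyapunov1_mode_lt0]).

    It remains to see that the formula applies: when a single pair crosses, the
    imaginary eigenvalues are just [i w0] and [- i w0], each simple, so the
    critical vector is a multiple of a mode ([simple_eigenvector]), and neither
    0 nor [2 i w0] is an eigenvalue, so the inverses in the definition are genuine
    ([jacobian96_unit]).  Both facts follow from the completeness of the modes
    ([mode_completeness]). *)

Set Implicit Arguments.
Unset Strict Implicit.
Unset Printing Implicit Defensive.

(** * The dispersion curve *)

Section DispersionCurve.
Variable R : realType.
Implicit Types (n j k l : nat) (x : R).

Lemma cos_double x : cos (2 * x) = 2 * cos x ^+ 2 - 1.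
Proof. by rewrite mulr_natl cos_mulr2n mulr_natl. Qed.

Lemma sin_double x : sin (2 * x) = 2 * (sin x * cos x).
Proof. by rewrite mulr_natl sin_mulr2n mulr_natl (mulrC (cos x)). Qed.

(** The angles [pi/3] and [2 pi/3] have the same sine, and the double-angle
    formula divides it out. *)
Lemma cos_pi_third : cos (pi / 3) = 1 / 2 :> R.
Proof.
have pi0 := @pi_gt0 R.
have s0 : 0 < sin (pi / 3 : R) by apply: sin_gt0_pi; lra.
have : sin (2 * (pi / 3) : R) = sin (pi / 3).
  have -> : 2 * (pi / 3) = - (pi / 3) + pi :> R by lra.
  by rewrite sinDpi sinN opprK.
rewrite sin_double => E; apply: (mulfI (lt0r_neq0 s0)); lra.
Qed.

Lemma f96E n j :
  f96 R n j = (1 - cos (angle R n j)) * (1 + 2 * cos (angle R n j)).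
Proof. by rewrite /f96 cos_double; ring. Qed.

Lemma g96E n j :
  g96 R n j = - (sin (angle R n j) * (1 + 2 * cos (angle R n j))).
Proof. by rewrite /g96 sin_double; ring. Qed.

Lemma angleE n j : (0 < n)%N -> n%:R * angle R n j = 2 * pi * j%:R.
Proof. by move=> n0; rewrite /angle mulrC divfK // pnatr_eq0 -lt0n. Qed.

(** Comparing an angle with a rational multiple of [pi] is a comparison of
    integers; through it, bounds on cosines become such comparisons. *)
Lemma angle_le n j a b : (0 < n)%N -> (0 < b)%N ->
  (angle R n j <= a%:R / b%:R * pi) = (2 * j * b <= a * n)%N.
Proof.
move=> n0 b0; rewrite -(ler_nat R) !natrM.
have nR : (0 : R) < n%:R by rewrite ltr0n.
have bR : (0 : R) < b%:R by rewrite ltr0n.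
have Ej : n%:R * angle R n j * b%:R = pi * (2 * j%:R * b%:R).
  by rewrite angleE //; ring.
have Ea : n%:R * (a%:R / b%:R * pi) * b%:R = pi * (a%:R * n%:R) :> R.
  by field; rewrite lt0r_neq0.
by rewrite -[LHS](ler_pM2l nR) -[LHS](ler_pM2r bR) Ej Ea ler_pM2l ?pi_gt0.
Qed.

Lemma angle_ge n j a b : (0 < n)%N -> (0 < b)%N ->
  (a%:R / b%:R * pi <= angle R n j) = (a * n <= 2 * j * b)%N.
Proof.
move=> n0 b0; rewrite -(ler_nat R) !natrM.
have nR : (0 : R) < n%:R by rewrite ltr0n.
have bR : (0 : R) < b%:R by rewrite ltr0n.
have Ej : n%:R * angle R n j * b%:R = pi * (2 * j%:R * b%:R).
  by rewrite angleE //; ring.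
have Ea : n%:R * (a%:R / b%:R * pi) * b%:R = pi * (a%:R * n%:R) :> R.
  by field; rewrite lt0r_neq0.
by rewrite -[LHS](ler_pM2l nR) -[LHS](ler_pM2r bR) Ej Ea ler_pM2l ?pi_gt0.
Qed.

Lemma angle_half n j : (0 < n)%N -> (2 * j <= n)%N ->
  angle R n j \in `[0, pi].
Proof.
move=> n0 jn; rewrite in_itv /=; apply/andP; split.
  by rewrite /angle !mulr_ge0 ?pi_ge0 ?invr_ge0 ?ler0n.
have := @angle_le n j 1 1 n0 isT; rewrite divr1 mul1r => ->; lia.
Qed.

Lemma cos_le_angle n j k : (0 < n)%N -> (2 * j <= n)%N -> (2 * k <= n)%N ->
  (cos (angle R n j) <= cos (angle R n k)) = (k <= j)%N.
Proof.
move=> n0 jn kn; rewrite leNgt ltr_cos ?angle_half // -leNgt.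
have nR : (0 : R) < n%:R by rewrite ltr0n.
rewrite -(ler_pM2l nR) !angleE // ler_pM2l ?ler_nat //.
by rewrite mulr_gt0 ?pi_gt0.
Qed.

Lemma cos_angle_ge n j a b : (0 < n)%N -> (0 < b)%N -> (a <= b)%N ->
  (2 * j <= n)%N ->
  (cos (a%:R / b%:R * pi) <= cos (angle R n j)) = (2 * j * b <= a * n)%N.
Proof.
move=> n0 b0 ab jn; rewrite leNgt ltr_cos ?angle_half // -?leNgt ?angle_le //.
have bR : (0 : R) < b%:R by rewrite ltr0n.
rewrite in_itv /= mulr_ge0 ?divr_ge0 ?pi_ge0 //=.
by rewrite ler_piMl ?pi_ge0 // ler_pdivrMr // mul1r ler_nat.
Qed.

Lemma cos_angle_le n j a b : (0 < n)%N -> (0 < b)%N -> (a <= b)%N ->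
  (2 * j <= n)%N ->
  (cos (angle R n j) <= cos (a%:R / b%:R * pi)) = (a * n <= 2 * j * b)%N.
Proof.
move=> n0 b0 ab jn; rewrite leNgt ltr_cos ?angle_half // -?leNgt ?angle_ge //.
have bR : (0 : R) < b%:R by rewrite ltr0n.
rewrite in_itv /= mulr_ge0 ?divr_ge0 ?pi_ge0 //=.
by rewrite ler_piMl ?pi_ge0 // ler_pdivrMr // mul1r ler_nat.
Qed.

Lemma angle_reflect n j : (0 < n)%N -> (j <= n)%N ->
  angle R n (n - j) = - angle R n j + pi *+ 2.
Proof.
move=> n0 jn; have nz : n%:R != 0 :> R by rewrite pnatr_eq0 -lt0n.
by apply: (mulfI nz); rewrite mulrDr mulrN !angleE // natrB //; ring.
Qed.

Lemma cos_angle_reflect n j : (0 < n)%N -> (j <= n)%N ->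
  cos (angle R n (n - j)) = cos (angle R n j).
Proof. by move=> n0 jn; rewrite angle_reflect // cosD2pi cosN. Qed.

Lemma sin_angle_reflect n j : (0 < n)%N -> (j <= n)%N ->
  sin (angle R n (n - j)) = - sin (angle R n j).
Proof. by move=> n0 jn; rewrite angle_reflect // sinD2pi sinN. Qed.

Lemma f96_reflect n j : (0 < n)%N -> (j <= n)%N ->
  f96 R n (n - j) = f96 R n j.
Proof. by move=> n0 jn; rewrite !f96E cos_angle_reflect. Qed.

Lemma g96_reflect n j : (0 < n)%N -> (j <= n)%N ->
  g96 R n (n - j) = - g96 R n j.
Proof.
by move=> n0 jn; rewrite !g96E cos_angle_reflect // sin_angle_reflect // mulNr.
Qed.

Lemma cos_angle_lt1 n j : (0 < j)%N -> (j < n)%N -> cos (angle R n j) < 1.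
Proof.
move=> j0 jn; have n0 : (0 < n)%N by lia.
rewrite lt_neqAle cos_le1 andbT.
wlog jn2 : j j0 jn / (2 * j <= n)%N => [W|].
  have [//|nj] := leqP (2 * j) n; first exact: W.
  rewrite -cos_angle_reflect ?(ltnW jn) //; apply: W; lia.
have := @cos_le_angle n 0 j n0 isT jn2.
have -> : cos (angle R n 0) = 1 by rewrite /angle mulr0 mul0r cos0.
by rewrite leNgt lt_neqAle cos_le1 andbT leqNgt j0 => /negbFE.
Qed.

(** The factor [1 - c] is positive, and [1 + 2 c] changes sign at the angle
    [2 pi / 3], that is at [j = n / 3]. *)
Lemma f96_gt0 n j : (0 < j)%N -> (2 * j <= n)%N ->
  (0 < f96 R n j) = (3 * j < n)%N.
Proof.
move=> j0 jn; have n0 : (0 < n)%N by lia.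
have c1 := @cos_angle_lt1 n j j0 ltac:(lia).
rewrite f96E pmulr_rgt0 ?subr_gt0 //.
have := @cos_angle_le n j 2 3 n0 isT isT jn.
have -> : cos (2%:R / 3%:R * pi) = - (1 / 2) :> R.
  by rewrite mulrAC -mulrA cos_double cos_pi_third; field.
move=> E; apply/idP/idP => [h|h].
  have : ~~ (cos (angle R n j) <= - (1 / 2)) by rewrite -ltNge; lra.
  rewrite E; lia.
have : ~~ (cos (angle R n j) <= - (1 / 2)) by rewrite E; lia.
rewrite -ltNge; lra.
Qed.

(** Hence the imaginary part of the eigenvalue does not vanish, and its sign
    decides which member of the pair is [i w0]. *)
Lemma g96_lt0 n j : (0 < j)%N -> (3 * j < n)%N -> g96 R n j < 0.
Proof.
move=> j0 jn; have n0 : (0 < n)%N by lia.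
have := @f96_gt0 n j j0 ltac:(lia); rewrite jn f96E pmulr_rgt0; last first.
  by rewrite subr_gt0 cos_angle_lt1 //; lia.
move=> c0; rewrite g96E oppr_lt0 mulr_gt0 //; apply: sin_gt0_pi.
have nR : (0 : R) < n%:R by rewrite ltr0n.
have pR := @pi_gt0 R.
have jR : (0 : R) < j%:R by rewrite ltr0n.
have jnR : 2 * j%:R < n%:R :> R by rewrite -natrM ltr_nat; lia.
apply/andP; split.
  by rewrite -(ltr_pM2l nR) mulr0 angleE // !mulr_gt0.
rewrite -(ltr_pM2l nR) angleE // [n%:R * _]mulrC -mulrA mulrCA.
by rewrite ltr_pM2l.
Qed.

(** The parabola [1 + c - 2 c^2] has its axis at [c = 1/4]. *)
Lemma f96_eq_cos n j k : f96 R n j = f96 R n k ->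
  cos (angle R n j) = cos (angle R n k) \/
  cos (angle R n j) + cos (angle R n k) = 1 / 2.
Proof.
rewrite !f96E => E; set a := cos _ in E *; set b := cos _ in E *.
have /eqP : (a - b) * (a + b - 1 / 2) = 0 by lra.
rewrite mulf_eq0 !subr_eq0 => /orP [] /eqP ->; [by left | by right].
Qed.

(** The parabola takes the value 1 at [c = 0] and at [c = 1/2], that is at the
    angles [pi / 2] and [pi / 3]. *)
Lemma f96_ge1 n j : (0 < j)%N -> (2 * j <= n)%N ->
  (1 <= f96 R n j) = (n <= 6 * j)%N && (4 * j <= n)%N.
Proof.
move=> j0 jn; have n0 : (0 < n)%N by lia.
have L := @cos_angle_le n j 1 3 n0 isT isT jn.
have U := @cos_angle_ge n j 1 2 n0 isT isT jn.
have e3 : cos (1%:R / 3%:R * pi) = 1 / 2 :> R.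
  by rewrite -cos_pi_third; congr cos; lra.
have e2 : cos (1%:R / 2%:R * pi) = 0 :> R.
  by rewrite -cos_pihalf; congr cos; lra.
rewrite e3 in L; rewrite e2 in U.
have -> : (n <= 6 * j)%N = (1 * n <= 2 * j * 3)%N by lia.
have -> : (4 * j <= n)%N = (2 * j * 2 <= 1 * n)%N by lia.
rewrite -L -U f96E; set c := cos _.
apply/idP/andP => [h|[h1 h2]]; last nra.
by split; nra.
Qed.

End DispersionCurve.

(** * The leading pair *)

Section LeadingPair.
Variable R : realType.
Implicit Types (n j k l m : nat).

Lemma pair_indexE n l :
  pair_index R n l <-> (0 < l)%N /\ (2 * l < n)%N.
Proof.
rewrite /pair_index ltr_pdivlMr // -natrM ltr_nat mulnC.
by split=> -[].
Qed.

Lemma hopf_indexE n l :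
  hopf_index R n l <-> [/\ (0 < l)%N, (2 * l < n)%N & (3 * l)%N <> n].
Proof.
have E : l%:R = n%:R / 3 :> R <-> (3 * l)%N = n.
  split=> [h|<-]; last by rewrite natrM; field.
  by apply/eqP; rewrite -(eqr_nat R) natrM h; apply/eqP; field.
split=> [[/pair_indexE[l0 ln] /E]|[l0 ln /E]] //.
by split=> //; apply/pair_indexE.
Qed.

Lemma l1_admissibleE n l :
  l1_admissible R n l <-> (0 < l)%N /\ (3 * l < n)%N.
Proof.
rewrite /l1_admissible ltr_pdivlMr // -natrM ltr_nat mulnC.
by split=> -[].
Qed.

(** The integer form of [is_l1].  The comparison extends to all [k <= n / 2]
    since [f96] is not positive from [n / 3] on; this is the range of indices
    that the bifurcation theory needs. *)
Definition leading n l := [/\ (0 < l)%N, (3 * l < n)%N &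
  forall k, (0 < k)%N -> (2 * k <= n)%N -> f96 R n k <= f96 R n l].

Lemma leading_gt0 n l : leading n l -> 0 < f96 R n l.
Proof. by case=> l0 ln _; rewrite f96_gt0 //; lia. Qed.

Lemma is_l1_leading n l : is_l1 R n l <-> leading n l.
Proof.
split=> [[/l1_admissibleE[l0 ln] M]|[l0 ln M]].
  split=> // k k0 kn; have [k3|k3] := boolP (3 * k < n)%N.
    by apply/M/l1_admissibleE.
  apply: (@le_trans _ _ 0); last by rewrite ltW // f96_gt0 //; lia.
  by rewrite leNgt f96_gt0.
split; first exact/l1_admissibleE.
by move=> k /l1_admissibleE[k0 kn]; apply: M => //; lia.
Qed.

Lemma is_l1_exists n : (4 <= n)%N -> exists l, is_l1 R n l.
Proof.
move=> n4; pose P (j : 'I_n) := (0 < j)%N && (3 * j < n)%N.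
have n1 : (1 < n)%N by lia.
have P1 : P (Ordinal n1) by rewrite /P /=; lia.
case: (@Order.TotalTheory.arg_maxP _ R 'I_n (Ordinal n1) P
         (fun j : 'I_n => f96 R n j) P1) => l /andP[l0 ln] M.
exists l; split; first exact/l1_admissibleE.
move=> k /l1_admissibleE[k0 kn]; have kn' : (k < n)%N by lia.
by apply: (M (Ordinal kn')); rewrite /P /= k0.
Qed.

(** A positive [FH k] means [f96 k > 0], and inversion reverses the order. *)
Lemma first_bifurcation_leading n l : hopf_index R n l ->
  first_bifurcation n (FH R n l) <-> leading n l.
Proof.
move=> hl; have [l0 l2 l3] := (hopf_indexE n l).1 hl.
split=> [[]|L].
  rewrite /FH invr_gt0 => fl _ M; split=> //.
    by rewrite -(@f96_gt0 R) // ltnW.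
  move=> k k0 kn; have [fk|fk] := ltP 0 (f96 R n k); last first.
    by rewrite (le_trans fk) // ltW.
  have k3 : (3 * k < n)%N by rewrite -(@f96_gt0 R).
  have := M k; rewrite invr_gt0 lef_pV2 ?posrE //; apply=> //.
  by apply/hopf_indexE; split=> //; lia.
have fl := leading_gt0 L; split; first by rewrite invr_gt0.
  by exists l.
move=> k /hopf_indexE[k0 k2 k3]; rewrite /FH invr_gt0 => fk.
by rewrite lef_pV2 ?posrE //; case: L => _ _; apply=> //; lia.
Qed.

(** Any integer between [n/6] and [n/4] has a value of at least 1, so the
    maximizer has one too; [n %/ 4] is such an integer unless [n = 7]. *)
Lemma leading_bounds n l : (4 <= n)%N -> n <> 7%N -> leading n l ->
  (n <= 6 * l)%N /\ (4 * l <= n)%N.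
Proof.
move=> n4 n7 [l0 l3 M]; apply/andP; rewrite -(@f96_ge1 R) //; last by lia.
have m0 : (0 < n %/ 4)%N by lia.
apply: le_trans (M (n %/ 4)%N m0 _); last by lia.
by rewrite f96_ge1 //; lia.
Qed.

(** With [c = cos (2 pi / 7)], index 1 beats index 2 when [2 c^2 + c < 3 / 2].
    From [cos (4 t) = cos (3 t)] at [t = 2 pi / 7] one gets
    [8 c^3 + 4 c^2 - 4 c - 1 = 0], whose root above [1/2] is below [13/20]. *)
Lemma leading_seven l : leading 7 l -> l = 1%N.
Proof.
case=> l0 l3 M; have [//|l2] : l = 1%N \/ l = 2 by lia.
have := M 1%N isT isT; subst l; rewrite !f96E.
have -> : angle R 7 2 = 2 * angle R 7 1 by rewrite /angle; lra.
have c1 : cos (angle R 7 1) < 1 by apply: cos_angle_lt1.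
have ch : 1 / 2 <= cos (angle R 7 1).
  rewrite -cos_pi_third; have := @cos_angle_ge R 7 1 1 3 isT isT isT isT.
  by rewrite mul1r mulrC => ->.
(* The angle is a seventh of the full turn, so four and three times it are
   opposite. *)
have E : cos (2 * (2 * angle R 7 1)) = cos (angle R 7 1 + 2 * angle R 7 1).
  rewrite -[RHS]cosN -[RHS]cosD2pi; congr cos; rewrite /angle -mulr_natl; lra.
move: E c1 ch; rewrite cosD !cos_double sin_double.
have := cos2sin2 (angle R 7 1).
set c := cos _; set s := sin _ => sc.
have -> : s * (2 * (s * c)) = 2 * c * s ^+ 2 by ring.
move=> E c1 ch.
have s2 : s ^+ 2 = 1 - c ^+ 2 by lra.
rewrite s2 in E.
have /eqP : (c - 1) * (8 * c ^+ 3 + 4 * c ^+ 2 - 4 * c - 1) = 0 by lra.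
rewrite mulf_eq0 => /orP [/eqP h|/eqP h] F; exfalso; first lra.
have F2 : 0 <= 2 * c ^+ 2 + c - 3 / 2.
  rewrite leNgt; apply/negP => neg; nra.
have : 0 <= c - 13 / 20 by nra.
nra.
Qed.

Lemma Re_lambda96 n k (F : R) : complex.Re (lambda96 n F k) = F * f96 R n k - 1.
Proof. by rewrite /= addrC. Qed.

Lemma pair_crossesE n k l : 0 < f96 R n l ->
  pair_crosses n k (FH R n l) <-> f96 R n k = f96 R n l.
Proof.
move=> fl; have fl' := lt0r_neq0 fl; split=> [[]|E].
  rewrite Re_lambda96 /FH => /eqP; rewrite subr_eq0 mulrC => /eqP h _.
  by rewrite -[RHS]mul1r -h divfK.
split; first by rewrite Re_lambda96 /FH E mulVf ?subrr.
exists 1 => // a b _ a1 b1 _; rewrite !Re_lambda96 E.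
rewrite nmulr_rlt0.
  by rewrite subr_gt0 -ltr_pdivrMr // div1r.
by rewrite subr_lt0 -ltr_pdivlMr // div1r.
Qed.

Lemma cos_angle_inj n j k : (2 * j <= n)%N -> (2 * k <= n)%N ->
  cos (angle R n j) = cos (angle R n k) -> j = k.
Proof.
move=> jn kn E; have [n0|n0] := posnP n; first by lia.
have jk := @cos_le_angle R n j k n0 jn kn.
have kj := @cos_le_angle R n k j n0 kn jn.
by move: jk kj; rewrite E lexx => jk kj; lia.
Qed.

(** A parabola takes each value at most twice. *)
Lemma f96_eq_three n k l m : (2 * k <= n)%N -> (2 * l <= n)%N ->
  (2 * m <= n)%N -> f96 R n k = f96 R n l -> f96 R n m = f96 R n l ->
  l <> k -> m = l \/ m = k.
Proof.
move=> kn ln mn /f96_eq_cos[/cos_angle_inj -> //|Ek] + lk.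
case/f96_eq_cos => [/cos_angle_inj -> //|Em]; first by left.
by right; apply: (@cos_angle_inj n) => //; lra.
Qed.

(** Indices above [n / 2] are reflected, so the bound holds for the whole
    spectrum and not only for one representative of each pair. *)
Lemma leading_max n l j : leading n l -> (j < n)%N -> f96 R n j <= f96 R n l.
Proof.
move=> L; have fl := leading_gt0 L; case: L => l0 l3 M jn.
have [->|j0] := posnP j.
  by rewrite f96E /angle mulr0 mul0r cos0 subrr mul0r ltW.
have [j2|j2] := leqP (2 * j) n; first exact: M.
by rewrite -f96_reflect ?(ltnW jn) //; [apply: M; lia | lia].
Qed.

(** When no other pair attains the maximum, the only index besides [l] that
    does is that of the conjugate eigenvalue. *)
Lemma leading_eq n l j : leading n l ->
  (forall k, (0 < k)%N -> (2 * k < n)%N -> f96 R n k = f96 R n l -> k = l) ->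
  (j < n)%N -> f96 R n j = f96 R n l -> j = l \/ j = (n - l)%N.
Proof.
move=> L U jn E; have fl := leading_gt0 L.
have fj : 0 < f96 R n j by rewrite E.
have j0 : (0 < j)%N.
  rewrite lt0n; apply/eqP => j0; move: fj.
  by rewrite j0 f96E /angle mulr0 mul0r cos0 subrr mul0r ltxx.
have [j2|j2] := leqP (2 * j) n.
  by left; apply: U => //; move: fj; rewrite f96_gt0 //; lia.
have Er : f96 R n (n - j) = f96 R n j by rewrite f96_reflect //; lia.
have j3 : (3 * (n - j) < n)%N by rewrite -(@f96_gt0 R) ?Er //; lia.
right; have : (n - j)%N = l by apply: U; rewrite ?Er //; lia.
by lia.
Qed.

End LeadingPair.

(** * The Jacobian matrix *)

(** Used to compare two computations of the differential of one coordinate. *)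
Lemma is_diff_unique (R : numFieldType) (V W : normedModType R)
    (f df dg : V -> W) x :
  is_diff x f df -> is_diff x f dg -> df = dg.
Proof. by move=> [_ <-] [_ <-]. Qed.

Section Jacobian.
Variables (R : realType) (n : nat).
Implicit Types (x v : 'rV[R]_n) (i j k : 'I_n).

Let coordf j : 'rV[R]_n -> R := fun x => x 0 j.

Lemma is_diff_coord j x : is_diff x (coordf j) (coordf j).
Proof.
have lin : linear (coordf j : _ -> R).
  by move=> a u v; rewrite /coordf !mxE.
pose mixin := GRing.isLinear.Build _ _ _ _ _ lin.
pose L : {linear _ -> _} := HB.pack (coordf j : _ -> R) mixin.
apply: DiffDef; first exact: differentiable_coord.
rewrite (_ : coordf j = L) //; apply: diff_lin; exact: coord_continuous.
Qed.

Let field96 F j : 'rV[R]_n -> R :=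
  coordf (ord_pred j) * (coordf (ordS j) - coordf (ord_pred (ord_pred j)))
  - coordf j + cst F.

Lemma lorenz96E F x j : lorenz96 F x 0 j = field96 F j x.
Proof. by rewrite mxE. Qed.

Lemma is_diff_field96 F x j :
  is_diff x (field96 F j)
    (fun v => x 0 (ord_pred j) * (v 0 (ordS j) - v 0 (ord_pred (ord_pred j)))
      + (x 0 (ordS j) - x 0 (ord_pred (ord_pred j))) * v 0 (ord_pred j)
      - v 0 j).
Proof.
have D k := is_diff_coord k x.
by apply: is_diff_eq; apply/funext => v; rewrite addr0.
Qed.

Lemma differentiable_lorenz96 F x : differentiable (@lorenz96 R n F) x.
Proof.
have -> : @lorenz96 R n F =
    \sum_(j < n) (fun y => field96 F j y *: delta_mx 0 j).
  apply/funext => y; rewrite fct_sumE; rewrite [LHS]row_sum_delta.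
  by apply: eq_bigr => j _; rewrite lorenz96E.
apply: differentiable_sum => j; apply: differentiableZl.
by have [] := is_diff_field96 F x j.
Qed.

(** Coordinate [j] of the differential is the differential of coordinate [j],
    by the chain rule with the linear coordinate map. *)
Lemma diff_lorenz96 F x v j :
  ('d (@lorenz96 R n F) x v) 0 j =
    x 0 (ord_pred j) * (v 0 (ordS j) - v 0 (ord_pred (ord_pred j)))
    + (x 0 (ordS j) - x 0 (ord_pred (ord_pred j))) * v 0 (ord_pred j) - v 0 j.
Proof.
have Dl : is_diff x (@lorenz96 R n F) ('d (lorenz96 F) x).
  exact/differentiableP/differentiable_lorenz96.
have Dc := is_diff_comp Dl (is_diff_coord j _).
have EF : coordf j \o @lorenz96 R n F = field96 F j.
  by apply/funext => y; rewrite /comp /coordf lorenz96E.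
rewrite EF in Dc; have E := is_diff_unique Dc (is_diff_field96 F x j).
exact: (congr1 (fun g : _ -> R => g v) E).
Qed.

End Jacobian.

(** * Fourier modes *)

Section FourierModes.
Variables (R : realType) (n : nat).
Hypothesis n_gt0 : (0 < n)%N.
Local Notation C := (R[i]).
Implicit Types (z : C) (k : 'I_n) (F : R).
Local Open Scope complex_scope.

(** At a constant state the factor [x_(j+1) - x_(j-2)] vanishes, so only its
    variation, multiplied by [F], contributes. *)
Lemma jacobian96E F k i :
  jacobian96 n F k i =
    (F * ((ordS k == i)%:R - (ord_pred (ord_pred k) == i)%:R)
     - (k == i)%:R)%:C.
Proof.
by rewrite !mxE diff_lorenz96 /trivial_equilibrium !mxE subrr mul0r addr0 !eqxx.
Qed.

Lemma ordS_eq k i : (ordS k == i) = (k == ord_pred i).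
Proof. by rewrite -[i in LHS](@ord_predK n) (inj_eq (@ordS_inj n)). Qed.

Lemma ord_pred_eq k i : (ord_pred k == i) = (k == ordS i).
Proof. by rewrite -[i in LHS](@ordSK n) (inj_eq (@ord_pred_inj n)). Qed.

Lemma sum_indicator (v : 'cV[C]_n) i :
  \sum_k (k == i)%:R * v k 0 = v i 0.
Proof.
rewrite (bigD1 i) //= eqxx mul1r big1 ?addr0 // => k /negPf ->.
by rewrite mul0r.
Qed.

Lemma jacobian96_mul F (v : 'cV[C]_n) k :
  (jacobian96 n F *m v) k 0 =
    F%:C * (v (ordS k) 0 - v (ord_pred (ord_pred k)) 0) - v k 0.
Proof.
rewrite !mxE -(sum_indicator v k) -(sum_indicator v (ordS k)).
rewrite -(sum_indicator v (ord_pred (ord_pred k))) -!sumrB mulr_sumr -sumrB.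
apply: eq_bigr => i _; rewrite jacobian96E.
rewrite rmorphB rmorphM rmorphB !rmorph_nat.
by rewrite ![_ == i]eq_sym; ring.
Qed.

Lemma jacobian96_tr_mul F (v : 'cV[C]_n) k :
  ((jacobian96 n F)^T *m v) k 0 =
    F%:C * (v (ord_pred k) 0 - v (ordS (ordS k)) 0) - v k 0.
Proof.
rewrite !mxE -(sum_indicator v k) -(sum_indicator v (ord_pred k)).
rewrite -(sum_indicator v (ordS (ordS k))) -!sumrB mulr_sumr -sumrB.
apply: eq_bigr => i _; rewrite mxE jacobian96E.
rewrite rmorphB rmorphM rmorphB !rmorph_nat ordS_eq !ord_pred_eq.
by ring.
Qed.

Definition mode z : 'cV[C]_n := \col_k z ^+ k.

Lemma root1_neq0 z : z ^+ n = 1 -> z != 0.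
Proof.
by apply: contra_eq_neq => ->; rewrite expr0n eqn0Ngt n_gt0 eq_sym oner_eq0.
Qed.

Lemma mode_ordS z k : z ^+ n = 1 -> mode z (ordS k) 0 = z * mode z k 0.
Proof. by move=> z1; rewrite !mxE expr_mod // exprS. Qed.

Lemma mode_ord_pred z k : z ^+ n = 1 ->
  mode z (ord_pred k) 0 = z^-1 * mode z k 0.
Proof.
move=> z1; have z0 := root1_neq0 z1; apply: (mulfI z0).
by rewrite mulrA divff // mul1r -mode_ordS // ord_predK.
Qed.

Definition mode_eigenvalue F z : C := F%:C * (z - z ^- 2) - 1.

(** The Jacobian is a combination of cyclic shifts, which multiply a mode by a
    power of [z]. *)
Lemma jacobian96_mode F z : z ^+ n = 1 ->
  jacobian96 n F *m mode z = mode_eigenvalue F z *: mode z.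
Proof.
move=> z1; have z0 := root1_neq0 z1; apply/colP => k.
rewrite jacobian96_mul [RHS]mxE mode_ordS // !mode_ord_pred //.
by rewrite /mode_eigenvalue; field.
Qed.

Lemma jacobian96_tr_mode F z : z ^+ n = 1 ->
  (jacobian96 n F)^T *m mode z = mode_eigenvalue F z^-1 *: mode z.
Proof.
move=> z1; have z0 := root1_neq0 z1; apply/colP => k.
rewrite jacobian96_tr_mul [RHS]mxE !mode_ordS // !mode_ord_pred //.
by rewrite /mode_eigenvalue; field.
Qed.

(** [l96B] commutes with the cyclic shift, so it sends a pair of modes to a
    multiple of their entrywise product, which is again a mode. *)
Lemma l96B_mode z w : z ^+ n = 1 -> w ^+ n = 1 ->
  l96B (mode z) (mode w) =
    (z^-1 * (w - w ^- 2) + w^-1 * (z - z ^- 2)) *: mode (z * w).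
Proof.
move=> z1 w1; have z0 := root1_neq0 z1; have w0 := root1_neq0 w1.
apply/colP => k; rewrite [LHS]mxE [RHS]mxE !mode_ordS // !mode_ord_pred //.
by rewrite !mxE exprMn; field; rewrite z0 w0.
Qed.

Lemma l96BZ a b (v w : 'cV[C]_n) : l96B (a *: v) (b *: w) = (a * b) *: l96B v w.
Proof. by apply/colP => k; rewrite !mxE; ring. Qed.

Lemma cdotZr a (v w : 'cV[C]_n) : cdot v (a *: w) = a * cdot v w.
Proof.
by rewrite /cdot mulr_sumr; apply: eq_bigr => k _; rewrite mxE mulrCA.
Qed.

Lemma conj_mode z : conjc z = z^-1 -> map_mx conjc (mode z) = mode z^-1.
Proof. by move=> cz; apply/colP => k; rewrite !mxE rmorphXn /= cz. Qed.

Lemma mulmx_invmx_eigen (N : 'M[C]_n) mu (v : 'cV[C]_n) :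
  N \in unitmx -> mu != 0 -> N *m v = mu *: v -> invmx N *m v = mu^-1 *: v.
Proof.
move=> Nu mu0 E; rewrite -[v in LHS](scalerK mu0) -E.
by rewrite -scalemxAr mulKmx.
Qed.

Lemma mulC_conj (w : C) :
  conjc w * w = (complex.Re w ^+ 2 + complex.Im w ^+ 2)%:C.
Proof.
case: w => a b; apply/eqP; rewrite eq_complex /=.
by apply/andP; split; apply/eqP; ring.
Qed.

Lemma Re_combination (m t : R) (a u : C) :
  complex.Re (- 2%:C * (m%:C * (2 * complex.Re a)%:C * a)
    - 2%:C * m%:C * t%:C * u) =
  - (2 * m) * (2 * complex.Re a ^+ 2 + t * complex.Re u).
Proof. by case: a u => [a b] [u v] /=; ring. Qed.

(** Put [w = z - z^-2].  The product of [q] and its conjugate is a multiple of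
    the constant mode, whose eigenvalue is -1, and [l96B q q] is a multiple of
    [mode (z^2)]; the inverses act on them as scalars.  Coupling back with [q] or
    its conjugate returns to [mode z], so both vectors paired with [p] are
    multiples of [q], with factors [(w + conj w) w / n] and
    [- 2 |z^3 - 1|^2 / (n mu)]. *)
Lemma lyapunov1_mode F w0 z d (p : 'cV[C]_n) :
  let A := jacobian96 n F in
  let M := (2 * Complex 0 w0)%:M - A in
  let mu := 2 * Complex 0 w0 - mode_eigenvalue F (z ^+ 2) in
  z ^+ n = 1 -> conjc z = z^-1 -> conjc d * d = n%:R^-1 ->
  A \in unitmx -> M \in unitmx -> mu != 0 -> cdot p (d *: mode z) = 1 ->
  lyapunov1 F w0 (d *: mode z) p =
    - (w0 * n%:R)^-1 * (2 * complex.Re (z - z ^- 2) ^+ 2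
      + (complex.Re (z ^+ 3 - 1) ^+ 2 + complex.Im (z ^+ 3 - 1) ^+ 2)
        * complex.Re mu^-1).
Proof.
move=> A M mu z1 cz cd Au Mu mu0 pq; have z0 := root1_neq0 z1.
have zV1 : z^-1 ^+ n = 1 by rewrite exprVn z1 invr1.
have zz1 : (z ^+ 2) ^+ n = 1 by rewrite -exprM mulnC exprM z1 expr1n.
have one1 : (1 : C) ^+ n = 1 by rewrite expr1n.
have qbar : map_mx conjc (d *: mode z) = conjc d *: mode z^-1.
  by rewrite map_mxZ conj_mode.
pose w := z - z ^- 2.
have cw : conjc w = z^-1 - z ^+ 2.
  by rewrite /w rmorphB /= fmorphV rmorphXn /= cz exprVn invrK.
have A1 : invmx A *m mode 1 = - mode 1.
  rewrite (@mulmx_invmx_eigen _ (-1)) ?jacobian96_mode ?oppr_eq0 ?oner_eq0 //.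
    by rewrite invrN1 scaleN1r.
  by rewrite /mode_eigenvalue expr1n invr1 subrr mulr0 add0r.
have M2 : invmx M *m mode (z ^+ 2) = mu^-1 *: mode (z ^+ 2).
  apply: mulmx_invmx_eigen => //.
  by rewrite mulmxBl mul_scalar_mx jacobian96_mode // -scalerBl.
have E1 : l96B (d *: mode z) (invmx A *m l96B (d *: mode z) (conjc d *: mode z^-1))
    = (n%:R^-1 * (w + conjc w) * w) *: (d *: mode z).
  rewrite l96BZ l96B_mode // divff // -!scalemxAr A1 -[- mode 1]scaleN1r !scalerA.
  rewrite l96BZ (l96B_mode z1 one1) mulr1 !scalerA; congr (_ *: _).
  by rewrite cw -cd /w; field.
have E2 : l96B (conjc d *: mode z^-1)
      (invmx M *m l96B (d *: mode z) (d *: mode z))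
    = (- (2 * n%:R^-1 * (conjc (z ^+ 3 - 1) * (z ^+ 3 - 1)) * mu^-1))
      *: (d *: mode z).
  rewrite l96BZ l96B_mode // -!scalemxAr -expr2 M2 !scalerA.
  rewrite l96BZ (l96B_mode zV1 zz1) !scalerA.
  have -> : z^-1 * z ^+ 2 = z by rewrite expr2 mulKf.
  congr (_ *: _).
  by rewrite -cd rmorphB rmorphXn rmorph1 /= cz; field; rewrite z0 mu0.
have cq a : cdot p (a *: (d *: mode z)) = a by rewrite cdotZr pq mulr1.
rewrite /lyapunov1 qbar -/A -/M E1 E2 !cq mulC_conj.
have -> : w + conjc w = (2 * complex.Re w)%:C.
  by rewrite addcJ rmorphM rmorph_nat.
have nE : n%:R^-1 = (n%:R^-1)%:C :> C by rewrite fmorphV rmorph_nat.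
have twoE : 2 = 2%:C :> C by rewrite rmorph_nat.
rewrite nE twoE -/w Re_combination !invfM; set r := w0^-1; set m := n%:R^-1.
by field.
Qed.

Definition unit_root (j : nat) : C :=
  Complex (cos (angle R n j)) (sin (angle R n j)).

Lemma conj_unit_root j : conjc (unit_root j) = (unit_root j)^-1.
Proof.
have E : conjc (unit_root j) * unit_root j = 1.
  by rewrite mulC_conj /= cos2Dsin2.
have z0 : unit_root j != 0.
  by apply: contra_eq_neq E => ->; rewrite mulr0 eq_sym oner_eq0.
by apply: (mulIf z0); rewrite E mulVf.
Qed.

Lemma unit_rootX j : unit_root j = unit_root 1 ^+ j.
Proof.
elim: j => [|j IH]; first by rewrite /unit_root /angle mulr0 mul0r cos0 sin0.
rewrite exprS -IH /unit_root.
have -> : angle R n j.+1 = angle R n 1 + angle R n j.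
  by rewrite /angle -mulrDl -mulrDr -natrD.
by rewrite cosD sinD; congr Complex; ring.
Qed.

Lemma unit_root1 j : unit_root j ^+ n = 1.
Proof.
rewrite unit_rootX exprAC -unit_rootX.
have -> : unit_root n = 1.
  have nz : n%:R != 0 :> R by rewrite pnatr_eq0 -lt0n.
  by rewrite /unit_root /angle mulfK // mulr_natl cos2pi sin2pi.
exact: expr1n.
Qed.

Lemma unit_root_eq1 j : (j < n)%N -> unit_root j = 1 -> j = 0%N.
Proof.
move=> jn [] E _; apply/eqP; rewrite -leqn0 leqNgt; apply/negP => j0.
by have := @cos_angle_lt1 R n j j0 jn; rewrite E ltxx.
Qed.

Lemma unit_root_inj (j k : nat) : (j < n)%N -> (k < n)%N ->
  unit_root j = unit_root k -> j = k.
Proof.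
wlog jk : j k / (j <= k)%N => [W jn kn E|jn kn E].
  case/orP: (leq_total j k) => ?; first exact: W.
  by apply/esym/W.
have : unit_root (k - j) = 1.
  rewrite unit_rootX; apply: (mulIf (root1_neq0 (unit_root1 j))).
  by rewrite mul1r (unit_rootX j) -exprD subnK // -(unit_rootX k) -(unit_rootX j).
by move/unit_root_eq1; lia.
Qed.

Lemma mode_eigenvalue_unit_root F j :
  mode_eigenvalue F (unit_root j) = conjc (lambda96 n F j).
Proof.
rewrite /mode_eigenvalue -exprVn -conj_unit_root /lambda96 /f96 /g96.
rewrite cos_double sin_double /unit_root.
set c := cos _; set s := sin _.
have s2 : s ^+ 2 = 1 - c ^+ 2 by exact: sin2cos2.
apply/eqP; rewrite eq_complex /=; apply/andP; split; apply/eqP; last by ring.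
have -> : (- s) * (- s) = 1 - c ^+ 2 by rewrite mulrNN -expr2 s2.
ring.
Qed.

(** A geometric sum whose ratio is an [n]-th root of unity. *)
Lemma unit_root_orthogonality (i k : 'I_n) :
  \sum_(j < n) (unit_root j)^-1 ^+ i * unit_root j ^+ k = n%:R * (i == k)%:R.
Proof.
have u0 := root1_neq0 (unit_root1 1).
have [->|ik] := eqVneq i k.
  under eq_bigr => j _.
    rewrite -exprMn mulVf ?expr1n ?(root1_neq0 (unit_root1 j)) //.
    over.
  by rewrite sumr_const card_ord mulr1.
pose r := (unit_root 1)^-1 ^+ i * unit_root 1 ^+ k.
have r1 : r != 1.
  apply/eqP => E; case/eqP: ik; apply: ord_inj.
  apply: unit_root_inj => //; rewrite (unit_rootX i) (unit_rootX k).
  have ui : unit_root 1 ^+ i != 0 by rewrite expf_neq0.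
  by apply: (mulfI (invr_neq0 ui)); rewrite mulVf // -E /r exprVn.
have : (r - 1) * \sum_(j < n) r ^+ j = 0.
  rewrite -subrX1 /r exprMn -!exprM mulnC [(k * n)%N]mulnC !exprM.
  by rewrite exprVn unit_root1 invr1 !expr1n mulr1 subrr.
move/eqP; rewrite mulf_eq0 subr_eq0 (negPf r1) /= => /eqP S.
rewrite mulr0 -[RHS]S; apply: eq_bigr => j _.
rewrite (unit_rootX j) /r exprMn -!exprVn -!exprM.
by rewrite [(j * i)%N]mulnC [(j * k)%N]mulnC.
Qed.

(** Discrete Fourier inversion: the modes span the whole space. *)
Lemma mode_completeness (v : 'cV[C]_n) :
  v = \sum_(j < n)
        (n%:R^-1 * ((mode (unit_root j)^-1)^T *m v) 0 0) *: mode (unit_root j).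
Proof.
have nz : n%:R != 0 :> C by rewrite pnatr_eq0 -lt0n.
apply/colP => k; rewrite summxE -(sum_indicator v k).
transitivity (\sum_i \sum_(j < n) n%:R^-1 * v i 0 *
    ((unit_root j)^-1 ^+ i * unit_root j ^+ k)).
  apply: eq_bigr => i _; rewrite -mulr_sumr unit_root_orthogonality.
  by field.
rewrite exchange_big; apply: eq_bigr => j _ /=.
rewrite !mxE mulr_sumr mulr_suml; apply: eq_bigr => i _.
by rewrite !mxE; ring.
Qed.

(** Transposing the Jacobian inverts the shifts, so the rows of Fourier
    coefficients are its left eigenvectors. *)
Lemma mode_left_eigen F z : z ^+ n = 1 ->
  (mode z^-1)^T *m jacobian96 n F = mode_eigenvalue F z *: (mode z^-1)^T.
Proof.
move=> z1; apply: trmx_inj; rewrite trmx_mul trmxK linearZ /= trmxK.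
by rewrite jacobian96_tr_mode ?invrK // exprVn z1 invr1.
Qed.

(** If the left modes are eigenvectors of [N] with nonzero eigenvalues, a vector
    in the kernel of [N] has no Fourier coefficient, hence vanishes. *)
Lemma unitmx_modes (N : 'M[C]_n) (nu : nat -> C) :
  (forall j, (j < n)%N -> nu j != 0 /\
     (mode (unit_root j)^-1)^T *m N = nu j *: (mode (unit_root j)^-1)^T) ->
  N \in unitmx.
Proof.
move=> H.
have K (v : 'cV[C]_n) : N *m v = 0 -> v = 0.
  move=> Nv; rewrite (mode_completeness v) big1 // => j _.
  have [nu0 E] := H j (ltn_ord j).
  have : nu j *: ((mode (unit_root j)^-1)^T *m v) = 0.
    by rewrite scalemxAl -E -mulmxA Nv mulmx0.
  move/eqP; rewrite scaler_eq0 (negPf nu0) /= => /eqP ->.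
  by rewrite mxE mulr0 scale0r.
rewrite -unitmx_tr -row_free_unit -kermx_eq0; apply/eqP/row_matrixP => i.
rewrite row0; apply: trmx_inj; rewrite trmx0; apply: K.
by apply: trmx_inj; rewrite trmx_mul trmxK -row_mul mulmx_ker row0 trmx0.
Qed.

Lemma jacobian96_unit F (mu : C) :
  (forall j, (j < n)%N -> mode_eigenvalue F (unit_root j) != mu) ->
  mu%:M - jacobian96 n F \in unitmx.
Proof.
move=> H; apply: (@unitmx_modes _ (fun j => mu - mode_eigenvalue F (unit_root j))).
move=> j jn; split; first by rewrite subr_eq0 eq_sym H.
by rewrite mulmxBr mul_mx_scalar mode_left_eigen ?unit_root1 // -scalerBl.
Qed.

(** Pairing the eigenvalue equation with the left modes shows that [v] has no
    Fourier coefficient except at [l]. *)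
Lemma simple_eigenvector F (mu : C) l (v : 'cV[C]_n) : (l < n)%N ->
  (forall j, (j < n)%N -> mode_eigenvalue F (unit_root j) = mu -> j = l) ->
  jacobian96 n F *m v = mu *: v -> exists d, v = d *: mode (unit_root l).
Proof.
move=> ln U E; rewrite {1}(mode_completeness v) (bigD1 (Ordinal ln)) //= big1.
  by rewrite addr0; eexists.
move=> j jl; have : (mode_eigenvalue F (unit_root j) - mu) *:
    ((mode (unit_root j)^-1)^T *m v) = 0.
  by rewrite scalerBl scalemxAl -mode_left_eigen ?unit_root1 // -mulmxA E
     -scalemxAr subrr.
move/eqP; rewrite scaler_eq0 subr_eq0 => /orP [/eqP h|/eqP ->].
  by case/eqP: jl; apply: ord_inj; apply: U.
by rewrite mxE mulr0 scale0r.
Qed.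

Lemma cdot_mode z d : conjc z = z^-1 -> z != 0 ->
  cdot (d *: mode z) (d *: mode z) = n%:R * (conjc d * d).
Proof.
move=> cz z0; rewrite /cdot.
under eq_bigr => k _.
  rewrite !mxE rmorphM rmorphXn /= cz.
  have -> : d^*%C * z^-1 ^+ k * (d * z ^+ k) = d^*%C * d.
    by rewrite exprVn; field; rewrite expf_neq0.
  over.
by rewrite sumr_const card_ord mulr_natl.
Qed.

End FourierModes.

(** * Sign of the first Lyapunov coefficient *)

Section Supercriticality.
Variables (R : realType) (n : nat).
Hypothesis n_gt0 : (0 < n)%N.
Local Notation C := (R[i]).
Local Open Scope complex_scope.

Lemma Re_inv_ge0 (w : C) : 0 <= complex.Re w -> 0 <= complex.Re w^-1.
Proof. by case: w => a b /= a0; rewrite divr_ge0 // addr_ge0 ?sqr_ge0. Qed.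

Lemma Re_mode_eigenvalue (F : R) (z : C) :
  complex.Re (mode_eigenvalue F z) = F * complex.Re (z - z ^- 2) - 1.
Proof.
by rewrite /mode_eigenvalue; case: (z - z ^- 2) => a b /=; rewrite mul0r subr0.
Qed.

Lemma conj_mode_eigenvalue (F : R) (z : C) :
  conjc (mode_eigenvalue F z) = mode_eigenvalue F (conjc z).
Proof.
rewrite /mode_eigenvalue rmorphB rmorphM rmorph1 rmorphB fmorphV rmorphXn.
by rewrite /= oppr0.
Qed.

(** Criticality of [z] makes [F * Re (z - z^-2) = 1], so the first term of
    [lyapunov1_mode] does not vanish; stability of [z^2] makes [Re mu >= 0], so
    the second term does not compete with it. *)
Lemma lyapunov1_mode_lt0 (F w0 : R) (z d : C) (p : 'cV[C]_n) :
  let A := jacobian96 n F in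
  let M := (2 * Complex 0 w0)%:M - A in
  z ^+ n = 1 -> conjc z = z^-1 -> conjc d * d = n%:R^-1 ->
  A \in unitmx -> M \in unitmx -> cdot p (d *: mode n z) = 1 ->
  0 < w0 -> complex.Re (mode_eigenvalue F z) = 0 ->
  complex.Re (mode_eigenvalue F (z ^+ 2)) <= 0 ->
  2 * Complex 0 w0 != mode_eigenvalue F (z ^+ 2) ->
  lyapunov1 F w0 (d *: mode n z) p < 0.
Proof.
move=> A M z1 cz cd Au Mu pq w00 Rz Rzz mu0.
rewrite lyapunov1_mode ?subr_eq0 //.
have mu_ge0 : 0 <= complex.Re (2 * Complex 0 w0 - mode_eigenvalue F (z ^+ 2)).
  by move: Rzz; case: (mode_eigenvalue F _) => a b /=; lra.
have := Re_inv_ge0 mu_ge0; set u := complex.Re _^-1 => u0.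
have a0 : complex.Re (z - z ^- 2) != 0.
  apply/eqP => E; move: Rz; rewrite Re_mode_eigenvalue E mulr0 sub0r.
  by move/eqP; rewrite oppr_eq0 oner_eq0.
rewrite nmulr_rlt0; last by rewrite oppr_lt0 invr_gt0 mulr_gt0 ?ltr0n.
rewrite ltr_wpDr //; first by rewrite mulr_ge0 // addr_ge0 ?sqr_ge0.
by rewrite mulr_gt0 // lt_neqAle sqr_ge0 eq_sym sqrf_eq0 a0.
Qed.

Variable l : nat.
Hypothesis L : leading R n l.
Hypothesis U : forall k, (0 < k)%N -> (2 * k < n)%N ->
  f96 R n k = f96 R n l -> k = l.

Let F := FH R n l.
Let w0 := `|complex.Im (lambda96 n F l)|.

Let fl : 0 < f96 R n l. Proof. exact: leading_gt0. Qed.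
Let F_gt0 : 0 < F. Proof. by rewrite invr_gt0. Qed.
Let ln : (l < n)%N. Proof. by case: L; lia. Qed.
Let l2n : (2 * l < n)%N. Proof. by case: L; lia. Qed.
Let gl : g96 R n l < 0. Proof. by apply: g96_lt0; case: L. Qed.

Lemma critical_frequency : w0 = - (F * g96 R n l).
Proof. by rewrite /w0 /= ltr0_norm // pmulr_rlt0. Qed.

Lemma critical_frequency_gt0 : 0 < w0.
Proof. by rewrite critical_frequency oppr_gt0 pmulr_rlt0. Qed.

Local Notation ev j := (mode_eigenvalue F (unit_root R n j)).

Lemma eigenvalueE j : ev j = Complex (F * f96 R n j - 1) (- (F * g96 R n j)).
Proof. by rewrite mode_eigenvalue_unit_root /= addrC. Qed.

Lemma eigenvalue_leading : ev l = Complex 0 w0.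
Proof. by rewrite eigenvalueE critical_frequency /F /FH mulVf ?subrr ?gt_eqF. Qed.

Lemma eigenvalue_reflect : ev (n - l) = Complex 0 (- w0).
Proof.
rewrite eigenvalueE critical_frequency f96_reflect ?g96_reflect ?(ltnW ln) //.
by rewrite /F /FH mulVf ?subrr ?gt_eqF // mulrN.
Qed.

(** At the first bifurcation no eigenvalue has crossed yet. *)
Lemma Re_eigenvalue_le0 j : (j < n)%N -> complex.Re (ev j) <= 0.
Proof.
move=> jn; rewrite eigenvalueE /= subr_le0 -(mulVf (lt0r_neq0 fl)).
by rewrite ler_pM2l // leading_max.
Qed.

(** A vanishing real part means [f96 j = f96 l], which singles out the critical
    pair. *)
Lemma imaginary_eigenvalue j y : (j < n)%N -> ev j = Complex 0 y ->
  (j = l /\ y = w0) \/ (j = (n - l)%N /\ y = - w0).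
Proof.
move=> jn E; have fj : f96 R n j = f96 R n l.
  move: (E); rewrite eigenvalueE => -[/eqP + _].
  rewrite subr_eq0 /F /FH mulrC => /eqP h.
  by rewrite -[RHS]mul1r -h divfK // gt_eqF.
have [jl|jl] := leading_eq L U jn fj; move: E; rewrite jl.
  by rewrite eigenvalue_leading => -[]; left.
by rewrite eigenvalue_reflect => -[]; right.
Qed.

Let w0_gt0 := critical_frequency_gt0.

(** The only imaginary eigenvalues are [i w0] and [- i w0], so 0 is not one. *)
Lemma jacobian96_critical_unit : jacobian96 n F \in unitmx.
Proof.
have : 0%:M - jacobian96 n F \in unitmx.
  apply: jacobian96_unit => // j jn; apply/eqP => E.
  by have [[_ h]|[_ h]] := imaginary_eigenvalue jn E; move: w0_gt0; lra.
rewrite -scalemx1 scale0r sub0r -scaleN1r unitmxZ //.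
by rewrite unitrN1.
Qed.

Let two_w0 : 2 * Complex 0 w0 = Complex 0 (2 * w0).
Proof. by apply/eqP; rewrite eq_complex /=; apply/andP; split; apply/eqP; ring. Qed.

Lemma nonresonant j : (j < n)%N -> ev j != 2 * Complex 0 w0.
Proof.
move=> jn; apply/eqP; rewrite two_w0 => E.
by have [[_ h]|[_ h]] := imaginary_eigenvalue jn E; move: w0_gt0; lra.
Qed.

(** The eigenvalue [i w0] is simple, so [q] is a multiple of the mode of index [l]
    and the explicit formula applies. *)
Lemma lyapunov1_critical_lt0 (q p : 'cV[C]_n) : critical_vectors F w0 q p ->
  lyapunov1 F w0 q p < 0.
Proof.
case=> _ Aq _ qq pq.
have [j jn E|d dE] := simple_eigenvector n_gt0 ln _ Aq.
  have [[]//|[_ h]] := imaginary_eigenvalue jn E.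
  by exfalso; move: w0_gt0; lra.
rewrite dE in qq pq *.
have nz : n%:R != 0 :> C by rewrite pnatr_eq0 -lt0n.
have z1 := unit_root1 R n_gt0 l.
have cz := conj_unit_root R n l.
have cd : conjc d * d = n%:R^-1.
  move: qq; rewrite cdot_mode ?(root1_neq0 n_gt0 z1) // => qq.
  by apply: (mulfI nz); rewrite qq divff.
have z2 : unit_root R n l ^+ 2 = unit_root R n (2 * l).
  by rewrite [RHS]unit_rootX mulnC exprM -unit_rootX.
apply: lyapunov1_mode_lt0 => //.
- exact: jacobian96_critical_unit.
- by apply: jacobian96_unit => // j jn; apply: nonresonant.
- by rewrite eigenvalue_leading.
- by rewrite z2; apply: Re_eigenvalue_le0.
- by rewrite z2 eq_sym; apply: nonresonant.
Qed.

(** The modes are eigenvectors of the Jacobian and of its transpose, so the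
    normalized mode serves as both [q] and [p]. *)
Lemma critical_vectors_exist : exists q p : 'cV[C]_n, critical_vectors F w0 q p.
Proof.
have nz : n%:R != 0 :> R by rewrite pnatr_eq0 -lt0n.
pose d : C := ((Num.sqrt n%:R)^-1)%:C.
have z1 := unit_root1 R n_gt0 l.
have z0 := root1_neq0 n_gt0 z1.
have cz := conj_unit_root R n l.
have dd : conjc d * d = n%:R^-1.
  rewrite conjc_real -rmorphM -expr2 exprVn sqr_sqrtr ?ler0n //.
  by rewrite fmorphV rmorph_nat.
pose q := d *: mode n (unit_root R n l).
have qq : cdot q q = 1.
  by rewrite cdot_mode // dd divff // pnatr_eq0 -lt0n.
exists q, q; split=> //.
- rewrite /q -scalemxAr (jacobian96_mode n_gt0 _ z1) eigenvalue_leading.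
  by rewrite !scalerA mulrC.
- rewrite /q -scalemxAr (jacobian96_tr_mode n_gt0 _ z1).
  have -> : mode_eigenvalue F (unit_root R n l)^-1 = - Complex 0 w0.
    have -> : - Complex 0 w0 = conjc (ev l).
      rewrite eigenvalue_leading.
      by apply/eqP; rewrite eq_complex /= oppr0 !eqxx.
    by rewrite conj_mode_eigenvalue cz.
  by rewrite !scalerA mulrC.
Qed.

Lemma leading_first_lyapunov_lt0 (ell : R) : first_lyapunov n l ell -> ell < 0.
Proof. by case=> w [q [p [-> cv ->]]]; apply: lyapunov1_critical_lt0. Qed.

Lemma leading_first_lyapunov_exists : exists ell : R, first_lyapunov n l ell.
Proof.
have [q [p cv]] := critical_vectors_exist.
by exists (lyapunov1 F w0 q p), w0, q, p.
Qed.

Lemma leading_hopf : hopf_bifurcation R n l.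
Proof.
have fz := lt0r_neq0 fl.
have hl : hopf_index R n l by apply/hopf_indexE; case: L => *; split=> //; lia.
split.
- by split=> //; apply/pair_crossesE.
- by move=> k /pair_indexE[k0 kn] /(pair_crossesE _ fl); apply: U.
- move=> /(congr1 (@complex.Im R)) /eqP /=.
  by rewrite mulf_eq0 gt_eqF //= lt_eqF.
- rewrite derive1E.
  have -> : (fun G => complex.Re (lambda96 n G l)) = (fun G => -1 + G * f96 R n l).
    by [].
  have D : is_derive (FH R n l) 1 (fun G : R => -1 + G * f96 R n l) (f96 R n l).
    apply: is_derive_eq.
    by rewrite scaler0 !add0r mul1r; exact: mulr1.
  by rewrite (@derive_val _ _ _ _ _ _ _ D); apply/eqP.
- split; first exact: leading_first_lyapunov_exists.
  by move=> ell /leading_first_lyapunov_lt0 h E; rewrite E ltxx in h.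
Qed.

End Supercriticality.

(** * The first bifurcation *)

Theorem proposition5 (R : realType) (n : nat) (hn : (4 <= n)%N) :
  [/\ exists l1, is_l1 R n l1,
      forall l1, is_l1 R n l1 ->
        [/\ first_bifurcation n (FH R n l1),
            hopf_bifurcation R n l1 \/
              (exists l2, hopf_hopf_bifurcation R n l1 l2),
            n <> 7%N -> n%:R / 6 <= l1%:R :> R /\ l1%:R <= n%:R / 4 :> R &
            n = 7%N -> l1 = 1%N] &
      forall l, hopf_index R n l -> first_bifurcation n (FH R n l) ->
        hopf_bifurcation R n l -> supercritical R n l].
Proof.
have n0 : (0 < n)%N by lia.
split=> [|l /is_l1_leading L|l hl /(first_bifurcation_leading hl) L H].
- exact: is_l1_exists.
- have [l0 l3 _] := L; have fl := leading_gt0 L.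
  have hl : hopf_index R n l by apply/hopf_indexE; split=> //; lia.
  split=> [||n7|n7].
  + exact/(first_bifurcation_leading hl).
  + have [U|] := pselect (forall k, (0 < k)%N -> (2 * k < n)%N ->
      f96 R n k = f96 R n l -> k = l); first by left; apply: leading_hopf.
    move=> /existsNP[k /not_implyP[k0 /not_implyP[kn /not_implyP[E kl]]]].
    have fk : 0 < f96 R n k by rewrite E.
    right; exists k; split.
    * by move=> /esym.
    * by split=> //; apply/pair_crossesE.
    * split; last exact/pair_crossesE.
      by apply/hopf_indexE; split=> //; move: fk; rewrite f96_gt0 //; lia.
    * move=> m /pair_indexE[m0 mn] /(pair_crossesE _ fl) Em.
      by apply: (@f96_eq_three R n k l m) => //; [lia..|move=> /esym].
  + have [b6 b4] := leading_bounds hn n7 L.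
    by rewrite ler_pdivrMr // ler_pdivlMr // -!natrM !ler_nat; lia.
  + by move: L; rewrite n7; apply: leading_seven.
- split=> // ell; case: H => _ H _ _ _; have fl := leading_gt0 L.
  apply: leading_first_lyapunov_lt0 => // k k0 kn E.
  by apply: H; [apply/pair_indexE|apply/pair_crossesE].
Qed.
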